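(* Let $N=J_2\oplus J_2\in\mathbb{M}_{4\times 4}$. A matrix $T\in \mathbb{M}_{4\times 4}$ is in $\mathrm{Col}(N)$ if and only if $$T=\begin{bmatrix} \gamma_{11} & \gamma_{12} & \gamma_{13} & \gamma_{14} \\ 0 & t\gamma_{11} & 0 & t\gamma_{13} \\ \gamma_{31} & \gamma_{32} & \gamma_{33} & \gamma_{34} \\ 0 & t\gamma_{31} & 0 & t\gamma_{33} \end{bmatrix},$$ where $t$ and $\gamma_{ij}$ are complex numbers such that $t(\gamma_{11}\gamma_{33}-\gamma_{13}\gamma_{31})\ne 0$.
   Context: $\mathbb{M}_{4\times 4}$ is the algebra of complex $4\times 4$ matrices acting on $\mathbb{C}^4$. $J_2=\begin{bmatrix}0&1\\0&0\end{bmatrix}$, so $N=J_2\oplus J_2$ is block diagonal with $Ne_1=Ne_3=0$, $Ne_2=e_1$, $Ne_4=e_3$. $\mathrm{Lat}(N)$ is the lattice of all subspaces $M\subseteq\mathbb{C}^4$ with $NM\subseteq M$, and $\mathrm{Col}(N)$ is the group of all invertible $S\in\mathbb{M}_{4\times 4}$ such that for every subspace $M$ of $\mathbb{C}^4$ one has $M\in\mathrm{Lat}(N)\iff SM\in\mathrm{Lat}(N)$. *)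

(* Defs.v *)
From HB Require Import structures.
From mathcomp Require Import all_boot all_order all_algebra.
From mathcomp Require Import reals.
From mathcomp.real_closed Require Import complex.

Set Implicit Arguments.
Unset Strict Implicit.
Unset Printing Implicit Defensive.

Import GRing.Theory.
Local Open Scope ring_scope.

Section Collineations.
Variables (F : fieldType) (n : nat).
Implicit Types (A S : 'M[F]_n) (M : {vspace 'cV[F]_n}).

(* Matrices act on column vectors by left multiplication, so this is v |-> A v. *)
Definition mxop A : 'End('cV[F]_n) := linfun (mulmx A).

Definition Lat A M : Prop := (mxop A @: M <= M)%VS.

Definition Col A S : Prop :=
  S \in unitmx /\
  forall M : {vspace 'cV[F]_n}, Lat A M <-> Lat A (mxop S @: M)%VS.

End Collineations.

Definition J2 (F : fieldType) : 'M[F]_2 := delta_mx 0 1.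

Definition N4 (F : fieldType) : 'M[F]_4 :=
  (block_mx (J2 F) 0 0 (J2 F) : 'M[F]_(2 + 2)).

(* The 4 x 4 matrix whose successive rows are listed in s. *)
Definition mx_of_rows (F : fieldType) (s : seq (seq F)) : 'M[F]_4 :=
  \matrix_(i < 4, j < 4) nth 0 (nth [::] s i) j.

(* Main.v *)
(* If S is in Col(N) then, for every v, the N-invariant subspace <v, Nv> has an
   N-invariant image <Sv, SNv>; since N^2 = 0, this forces NSv to be a multiple
   of SNv. Comparing the multiples at e2, e4 and e2 + e4 yields a single scalar
   t with NS = t SN, which read entrywise is the stated shape. The determinant
   of a matrix of this shape is (t (g11 g33 - g13 g31))^2. Conversely NS = t SN
   with S invertible and t nonzero makes S carry Lat(N) onto itself. *)
Require Import Defs.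
From mathcomp Require Import all_boot all_order all_algebra.
From mathcomp Require Import reals ring.
From mathcomp.real_closed Require Import complex.

Set Implicit Arguments.
Unset Strict Implicit.
Unset Printing Implicit Defensive.

Import GRing.Theory.
Local Open Scope ring_scope.

Lemma mxopE (F : fieldType) (n : nat) (A : 'M[F]_n) (v : 'cV[F]_n) :
  mxop A v = A *m v.
Proof. by rewrite lfunE. Qed.

Lemma mem_mxop_img (F : fieldType) (n : nat) (S : 'M[F]_n)
    (M : {vspace 'cV[F]_n}) (v : 'cV[F]_n) :
  S \in unitmx -> (S *m v \in mxop S @: M)%VS = (v \in M).
Proof.
move=> uS; apply/idP/idP => [/memv_imgP[w wM]|vM]; last first.
  by rewrite -mxopE memv_img.
by rewrite mxopE => /(congr1 (mulmx (invmx S))); rewrite !mulKmx // => ->.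
Qed.

Lemma LatP (F : fieldType) (n : nat) (A : 'M[F]_n) (M : {vspace 'cV[F]_n}) :
  Lat A M <-> forall v, v \in M -> A *m v \in M.
Proof.
split=> [/subvP sAM v vM | AM].
  by apply: sAM; rewrite -mxopE memv_img.
by apply/subvP=> _ /memv_imgP[v vM ->]; rewrite mxopE AM.
Qed.

(** Since $NSv = t\,SNv$ with $t\neq 0$ and $S$ is injective, $NSv\in SM$ exactly when $Nv\in M$. *)
Lemma Col_of_semicommute (F : fieldType) (n : nat) (N S : 'M[F]_n) (t : F) :
  S \in unitmx -> t != 0 -> N *m S = t *: (S *m N) -> Col N S.
Proof.
move=> uS t0 NS; split=> // M.
have NSv v : (N *m (S *m v) \in mxop S @: M)%VS = (N *m v \in M).
  rewrite mulmxA NS -scalemxAl -mulmxA -[RHS](mem_mxop_img _ _ uS).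
  by rewrite rpredZeq (negPf t0).
split=> /LatP NM; apply/LatP=> v vM.
  by case/memv_imgP: vM => w wM ->; rewrite mxopE NSv NM.
by rewrite -NSv NM // mem_mxop_img.
Qed.

Lemma Col_sq0_local (F : fieldType) (n : nat) (N S : 'M[F]_n) (v : 'cV[F]_n) :
  N *m N = 0 -> Col N S -> exists b, N *m (S *m v) = b *: (S *m (N *m v)).
Proof.
move=> N2 [_ colS].
have NN (w : 'cV[F]_n) : N *m (N *m w) = 0 by rewrite mulmxA N2 mul0mx.
(* $\langle w, Nw\rangle$ is invariant because $N^2=0$, so its image $\langle Sw, SNw\rangle$ is
   invariant and contains $NSw$. *)
have span (w : 'cV[F]_n) : exists a b,
    N *m (S *m w) = a *: (S *m w) + b *: (S *m (N *m w)).
  have /colS/LatP : Lat N (<[w]> + <[N *m w]>)%VS.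
    apply/LatP => _ /memv_addP[_ /vlineP[a ->]] [_ /vlineP[b ->]] ->.
    rewrite mulmxDr -!scalemxAr NN scaler0 addr0.
    by rewrite memvZ // (subvP (addvSr _ _)) ?memv_line.
  move=> /(_ (S *m w)); rewrite limgD !limg_line !mxopE.
  rewrite (subvP (addvSl _ _)) ?memv_line // => /(_ isT).
  by case/memv_addP=> _ /vlineP[a ->] [_ /vlineP[b ->]] ->; exists a, b.
(* For $Nw=0$ the span relation reads $NSw = a\,Sw$; applying $N$ gives $a\,NSw=0$, and either
   factor being zero yields $NSw=0$. *)
have ker (w : 'cV[F]_n) : N *m w = 0 -> N *m (S *m w) = 0.
  move=> Nw; have [a [b]] := span w; rewrite Nw mulmx0 scaler0 addr0 => NSw.
  have := NN (S *m w); rewrite NSw -scalemxAr => /eqP.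
  by rewrite scaler_eq0 => /orP[/eqP->|/eqP NS0]; rewrite ?scale0r // -NSw.
have [a [b NSv]] := span v.
(* Applying $N$ to $NSv = a\,Sv + b\,SNv$ kills the last term, as $Nv\in\ker N$ and $S$ preserves
   $\ker N$. What remains is $a\,NSv=0$. *)
have := NN (S *m v).
rewrite {1}NSv mulmxDr -!scalemxAr (ker _ (NN v)) scaler0 addr0 => /eqP.
rewrite scaler_eq0 => /orP[/eqP a0|/eqP ->].
  by exists b; rewrite NSv a0 scale0r add0r.
by exists 0; rewrite scale0r.
Qed.

Lemma ord4P (P : 'I_4 -> Prop) : P 0 -> P 1 -> P 2 -> P 3 -> forall i, P i.
Proof.
move=> P0 P1 P2 P3; case=> [[|[|[|[|//]]]] i4].
- by rewrite (_ : Ordinal i4 = 0) //; apply: val_inj.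
- by rewrite (_ : Ordinal i4 = 1) //; apply: val_inj.
- by rewrite (_ : Ordinal i4 = 2) //; apply: val_inj.
- by rewrite (_ : Ordinal i4 = 3) //; apply: val_inj.
Qed.

(** An empty list encodes a zero row: [nth] falls back on its default [0]. *)
Lemma N4E (F : fieldType) :
  N4 F = mx_of_rows [:: [:: 0; 1; 0; 0]; [::]; [:: 0; 0; 0; 1]; [::]].
Proof.
apply/matrixP; apply: ord4P; apply: ord4P; rewrite [RHS]mxE /= /N4 /J2;
  by do 2 (rewrite mxE; case: splitP; case=> [[|[|//]]] ? //= _); rewrite mxE.
Qed.

(** Brings an arbitrary matrix into the row-list form required by the product formulas for [N4]. *)
Lemma mx_of_rows_eta (F : fieldType) (A : 'M[F]_4) :
  A = mx_of_rows [:: [:: A 0 0; A 0 1; A 0 2; A 0 3];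
                     [:: A 1 0; A 1 1; A 1 2; A 1 3];
                     [:: A 2 0; A 2 1; A 2 2; A 2 3];
                     [:: A 3 0; A 3 1; A 3 2; A 3 3]].
Proof. by apply/matrixP; apply: ord4P; apply: ord4P; rewrite [RHS]mxE. Qed.

Lemma mulN4mx (F : fieldType) (r0 r1 r2 r3 : seq F) :
  N4 F *m mx_of_rows [:: r0; r1; r2; r3] = mx_of_rows [:: r1; [::]; r3; [::]].
Proof.
rewrite N4E; apply/matrixP; apply: ord4P => j;
  by rewrite !mxE !big_ord_recl big_ord0 !mxE /=
             ?nth_nil ?mul0r ?mul1r ?add0r ?addr0.
Qed.

Lemma mulmxN4 (F : fieldType)
    (a00 a01 a02 a03 a10 a11 a12 a13 a20 a21 a22 a23 a30 a31 a32 a33 : F) :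
  mx_of_rows [:: [:: a00; a01; a02; a03]; [:: a10; a11; a12; a13];
                 [:: a20; a21; a22; a23]; [:: a30; a31; a32; a33]] *m N4 F =
  mx_of_rows [:: [:: 0; a00; 0; a02]; [:: 0; a10; 0; a12];
                 [:: 0; a20; 0; a22]; [:: 0; a30; 0; a32]].
Proof.
rewrite N4E; apply/matrixP; apply: ord4P; apply: ord4P;
  by rewrite !mxE !big_ord_recl big_ord0 !mxE /=
             ?mulr0 ?mulr1 ?add0r ?addr0.
Qed.

Lemma N4_sq0 (F : fieldType) : N4 F *m N4 F = 0.
Proof.
rewrite {2}N4E mulN4mx.
by apply/matrixP; apply: ord4P => j; rewrite !mxE /= nth_nil.
Qed.

Lemma N4_delta (F : fieldType) :
  [/\ N4 F *m delta_mx 0 0 = 0 :> 'cV_4,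
      N4 F *m delta_mx 1 0 = delta_mx 0 0 :> 'cV_4,
      N4 F *m delta_mx 2 0 = 0 :> 'cV_4
    & N4 F *m delta_mx 3 0 = delta_mx 2 0 :> 'cV_4].
Proof.
rewrite -!colE N4E; split; apply/matrixP; apply: ord4P => j;
  by rewrite [j]ord1 !mxE.
Qed.

Lemma Col_N4_semicommute (F : fieldType) (S : 'M[F]_4) :
  Col (N4 F) S -> exists t, N4 F *m S = t *: (S *m N4 F).
Proof.
move=> colS; have uS := colS.1.
have loc v := Col_sq0_local v (N4_sq0 F) colS.
have [N0 N1 N2 N3] := N4_delta F.
have [a Na] := loc (delta_mx 1 0); have [b Nb] := loc (delta_mx 3 0).
have [t Nt] := loc (delta_mx 1 0 + delta_mx 3 0).
have [c Nc] := loc (delta_mx 0 0); have [d Nd] := loc (delta_mx 2 0).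
(* Indices start at 0, so [delta_mx 1 0] is $e_2$. Expanding $NS(e_2+e_4)$ by linearity and
   cancelling $S$ compares the three scalars on the independent vectors $e_1, e_3$. *)
have ab : a *: delta_mx 0 0 + b *: delta_mx 2 0
        = t *: (delta_mx 0 0 + delta_mx 2 0) :> 'cV[F]_4.
  apply: (can_inj (mulKmx uS)).
  by rewrite -scalemxAr -N1 -N3 -mulmxDr -Nt !mulmxDr Na Nb -!scalemxAr N1 N3.
have a_t : a = t.
  by move/matrixP: ab => /(_ 0 0); rewrite !mxE /= !mulr1 !mulr0 !addr0 mulr1.
have b_t : b = t.
  by move/matrixP: ab => /(_ 2 0); rewrite !mxE /= !mulr1 !mulr0 !add0r mulr1.
exists t; suff eq_col : forall j, col j (N4 F *m S) = col j (t *: (S *m N4 F)).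
  by apply/matrixP=> i j; have /colP/(_ i) := eq_col j; rewrite mxE [RHS]mxE.
(* On $e_1$ and $e_3$ both sides vanish; on $e_2$ and $e_4$ the scalar is $t$. *)
apply: ord4P; rewrite !colE -scalemxAl -!mulmxA.
- by rewrite Nc N0 mulmx0 !scaler0.
- by rewrite Na a_t.
- by rewrite Nd N2 mulmx0 !scaler0.
- by rewrite Nb b_t.
Qed.

(** In the basis order $e_1,e_3,e_2,e_4$ the matrix is block upper triangular with diagonal blocks
    $G$ and $tG$, whence the square. The proof checks this by cofactor expansion. *)
Lemma det_col_form (F : fieldType) (t g11 g12 g13 g14 g31 g32 g33 g34 : F) :
  \det (mx_of_rows
          [:: [:: g11; g12;     g13; g14    ];
              [:: 0;   t * g11; 0;   t * g13];
              [:: g31; g32;     g33; g34    ];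
              [:: 0;   t * g31; 0;   t * g33]])
  = (t * (g11 * g33 - g13 * g31)) ^+ 2.
Proof.
rewrite (expand_det_row _ 0) !big_ord_recl big_ord0 /cofactor.
do 2 rewrite !(expand_det_row _ 0) !big_ord_recl !big_ord0 /cofactor.
rewrite !det_mx11 !mxE /=.
ring.
Qed.

Theorem theorem1 (R : realType) (T : 'M[R[i]]_4) :
  Col (N4 (R[i])) T <->
  exists t g11 g12 g13 g14 g31 g32 g33 g34 : R[i],
    T = mx_of_rows
          [:: [:: g11; g12;     g13; g14    ];
              [:: 0;   t * g11; 0;   t * g13];
              [:: g31; g32;     g33; g34    ];
              [:: 0;   t * g31; 0;   t * g33]]
    /\ t * (g11 * g33 - g13 * g31) != 0.
Proof.
split=> [colT | [t [g11 [g12 [g13 [g14 [g31 [g32 [g33 [g34 [-> tD0]]]]]]]]]]].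
  have [t NT] := Col_N4_semicommute colT.
  exists t, (T 0 0), (T 0 1), (T 0 2), (T 0 3).
  exists (T 2 0), (T 2 1), (T 2 2), (T 2 3).
  have TE : T = mx_of_rows
      [:: [:: T 0 0; T 0 1;     T 0 2; T 0 3    ];
          [:: 0;     t * T 0 0; 0;     t * T 0 2];
          [:: T 2 0; T 2 1;     T 2 2; T 2 3    ];
          [:: 0;     t * T 2 0; 0;     t * T 2 2]].
    move: NT; rewrite [in LHS](mx_of_rows_eta T) [in RHS](mx_of_rows_eta T).
    rewrite mulN4mx mulmxN4 => /matrixP NT.
    rewrite [LHS]mx_of_rows_eta.
    (* Rows 0 and 2 of $NT$ are rows 1 and 3 of $T$, so these eight entries of $NT = t\,TN$
       determine those rows. *)
    have := (NT 0 0, NT 0 1, NT 0 2, NT 0 3, NT 2 0, NT 2 1, NT 2 2, NT 2 3).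
    by rewrite !mxE /= !mulr0 => -[[[[[[[-> ->] ->] ->] ->] ->] ->] ->].
  split=> //; apply: contraTneq colT.1 => tD0.
  by rewrite TE unitmxE det_col_form tD0 expr0n unitr0.
apply: (@Col_of_semicommute _ _ _ _ t).
- by rewrite unitmxE det_col_form unitfE expf_neq0.
- by apply: contraNneq tD0 => ->; rewrite mul0r.
rewrite mulN4mx mulmxN4.
by apply/matrixP; apply: ord4P; apply: ord4P; rewrite !mxE /= ?mulr0.
Qed.
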